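(* Let $u_1,u_2\in\mathbb{R}^m$ and $v_1,v_2\in\mathbb{R}^n$. Let $\theta_u\in[0,\pi]$ be the angle between $u_1$ and $u_2$, and let $\theta_v\in[0,\pi]$ be the angle between $v_1$ and $v_2$. Then (Frobenius norm) $$\|u_1v_1^t+u_2v_2^t\|_F^*=\|u_1v_1^t+u_2v_2^t\|_F=\sqrt{\|u_1\|_2^2\|v_1\|_2^2+\|u_2\|_2^2\|v_2\|_2^2+2\|u_1\|_2\|v_1\|_2\|u_2\|_2\|v_2\|_2\cos(\theta_u)\cos(\theta_v)},$$ and (nuclear norm, or trace norm) $$\|u_1v_1^t+u_2v_2^t\|_2^*=\sqrt{\|u_1\|_2^2\|v_1\|_2^2+\|u_2\|_2^2\|v_2\|_2^2+2\|u_1\|_2\|v_1\|_2\|u_2\|_2\|v_2\|_2\cos(\theta_u-\theta_v)}.$$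
   Context: For vectors $\|\cdot\|_2$ is the Euclidean norm. For real $m\times n$ matrices, $\|\cdot\|_F$ is the Frobenius norm and $\|\cdot\|_2$ is the spectral norm (largest singular value). For a norm $\|\cdot\|$ on $\mathbb{R}^{m\times n}$, the dual norm is $\|G\|^*=\sup_{\|B\|=1}\operatorname{tr}(G^tB)$; thus $\|\cdot\|_F^*$ is the dual of the Frobenius norm, and $\|\cdot\|_2^*$ is the dual of the spectral norm, which equals the nuclear (trace) norm, i.e. the sum of the singular values counted with multiplicity. If one of the vectors is zero, the corresponding angle may be taken to be any value in $[0,\pi]$ (the term containing it vanishes). The superscript $t$ denotes transpose. *)

(* Defs.v *)
From HB Require Import structures.
From mathcomp Require Import all_boot all_order all_algebra.
From mathcomp Require Import all_classical all_reals all_analysis.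

Set Implicit Arguments.
Unset Strict Implicit.
Unset Printing Implicit Defensive.

Import Order.TTheory GRing.Theory Num.Theory.
Local Open Scope classical_set_scope.
Local Open Scope ring_scope.

Definition dot (R : realType) (m : nat) (u v : 'cV[R]_m) : R :=
  \sum_(i < m) u i 0 * v i 0.

Definition norm2 (R : realType) (m : nat) (u : 'cV[R]_m) : R :=
  Num.sqrt (\sum_(i < m) u i 0 ^+ 2).

(* If u = 0 or v = 0, every theta in [0, pi] is an angle between u and v. *)
Definition is_angle (R : realType) (m : nat) (theta : R) (u v : 'cV[R]_m)
    : Prop :=
  0 <= theta <= pi /\
  (u != 0 -> v != 0 -> cos theta = dot u v / (norm2 u * norm2 v)).

Definition frobenius_norm (R : realType) (m n : nat) (A : 'M[R]_(m, n)) : R :=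
  Num.sqrt (\sum_(i < m) \sum_(j < n) A i j ^+ 2).

(* The square roots of the eigenvalues of A^T A. When m < n this may add the
   value 0 to the min(m, n) singular values, which does not affect the
   largest one. *)
Definition singular_values (R : realType) (m n : nat) (A : 'M[R]_(m, n))
    : set R :=
  [set s : R | 0 <= s /\ eigenvalue (A^T *m A) (s ^+ 2)].

(* singular_values A is finite, and nonempty for n > 0 (A^T A is positive
   semidefinite), so that sup is then a maximum; for n = 0 it is sup set0 = 0. *)
Definition spectral_norm (R : realType) (m n : nat) (A : 'M[R]_(m, n)) : R :=
  sup (singular_values A).

(* For a norm N and m, n > 0 the set is nonempty and bounded, so that sup is
   the true supremum; if m = 0 or n = 0 it is empty and sup set0 = 0. *)
Definition dual_norm (R : realType) (m n : nat) (N : 'M[R]_(m, n) -> R)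
    (G : 'M[R]_(m, n)) : R :=
  sup [set \tr (G^T *m B) | B in [set B : 'M[R]_(m, n) | N B = 1]].

(* Main.v *)
(** The dual of the Frobenius norm is computed by Cauchy-Schwarz.  For the
    spectral norm, choose contractions E and F with u_i = E x_i, v_i = F y_i,
    where x_i, y_i are plane vectors of the same lengths and angles.  Since E
    and F preserve the lengths of these vectors, E^T E x_i = x_i and
    F^T F y_i = y_i, so u1 v1^T + u2 v2^T = E M F^T has the same dual norm as
    the 2x2 matrix M = x1 y1^T + x2 y2^T.  Here
    det M = |u1||u2||v1||v2| sin theta_u sin theta_v >= 0, because both angles
    lie in [0, pi], so the nuclear norm t of M satisfies
    t^2 = |M|_F^2 + 2 det M, and Q = M + cof M is t times a rotation, which
    attains the dual norm.  The upper bound follows from the Cayley-Hamilton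
    identity t^2 M = Q M^T M + (det M) Q. *)

Require Import Defs.
From mathcomp Require Import all_boot all_order all_algebra.
From mathcomp Require Import all_classical all_reals all_analysis.
From mathcomp Require Import ring lra.
Set Implicit Arguments.
Unset Strict Implicit.
Unset Printing Implicit Defensive.
Import Order.TTheory GRing.Theory Num.Theory.
Local Open Scope ring_scope.

(** * The Frobenius inner product and Cauchy-Schwarz inequalities *)

Definition mxip (R : realType) (m n : nat) (A B : 'M[R]_(m, n)) : R :=
  \tr (A^T *m B).

Section InnerProduct.
Context {R : realType}.

Lemma mxipE (m n : nat) (A B : 'M[R]_(m, n)) :
  mxip A B = \sum_i \sum_j A i j * B i j.
Proof.
rewrite /mxip /mxtrace exchange_big /=; apply: eq_bigr => j _.
by rewrite mxE; apply: eq_bigr => i _; rewrite mxE.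
Qed.

Lemma mxipC (m n : nat) (A B : 'M[R]_(m, n)) : mxip A B = mxip B A.
Proof. by rewrite /mxip -mxtrace_tr trmx_mul trmxK. Qed.

Lemma mxipDl (m n : nat) (A B C : 'M[R]_(m, n)) :
  mxip (A + B) C = mxip A C + mxip B C.
Proof. by rewrite /mxip linearD mulmxDl linearD. Qed.

Lemma mxipZl (m n : nat) c (A B : 'M[R]_(m, n)) :
  mxip (c *: A) B = c * mxip A B.
Proof. by rewrite /mxip linearZ -scalemxAl mxtraceZ. Qed.

Lemma mxipDr (m n : nat) (A B C : 'M[R]_(m, n)) :
  mxip C (A + B) = mxip C A + mxip C B.
Proof. by rewrite mxipC mxipDl !(mxipC C). Qed.

Lemma mxipZr (m n : nat) c (A B : 'M[R]_(m, n)) :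
  mxip A (c *: B) = c * mxip A B.
Proof. by rewrite mxipC mxipZl mxipC. Qed.

Lemma mxip0l (m n : nat) (A : 'M[R]_(m, n)) : mxip 0 A = 0.
Proof. by rewrite /mxip trmx0 mul0mx mxtrace0. Qed.

Lemma mxip0r (m n : nat) (A : 'M[R]_(m, n)) : mxip A 0 = 0.
Proof. by rewrite mxipC mxip0l. Qed.

Lemma mxip_mull (m n p : nat) (A : 'M[R]_(m, n)) (B : 'M[R]_(n, p)) C :
  mxip (A *m B) C = mxip B (A^T *m C).
Proof. by rewrite /mxip trmx_mul mulmxA. Qed.

Lemma mxip_mulr (m n p : nat) (A : 'M[R]_(m, n)) (B : 'M[R]_(n, p)) C :
  mxip (A *m B) C = mxip A (C *m B^T).
Proof. by rewrite /mxip trmx_mul -mulmxA mxtrace_mulC mulmxA. Qed.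

Lemma mxip_ge0 (m n : nat) (A : 'M[R]_(m, n)) : 0 <= mxip A A.
Proof.
by rewrite mxipE; do 2!apply: sumr_ge0 => ? _; rewrite -expr2 sqr_ge0.
Qed.

Lemma mxip_eq0 (m n : nat) (A : 'M[R]_(m, n)) : (mxip A A == 0) = (A == 0).
Proof.
apply/eqP/eqP => [|->]; last by rewrite mxip0l.
rewrite mxipE => /eqP; rewrite psumr_eq0; last first.
  by move=> i _; apply: sumr_ge0 => ? _; rewrite -expr2 sqr_ge0.
move=> /allP A0; apply/matrixP => i j; rewrite mxE.
have := A0 i (mem_index_enum i); rewrite /= psumr_eq0; last first.
  by move=> ? _; rewrite -expr2 sqr_ge0.
by move=> /allP/(_ j (mem_index_enum j)); rewrite /= mulf_eq0 orbb => /eqP.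
Qed.

Lemma mxip_gt0 (m n : nat) (A : 'M[R]_(m, n)) : (0 < mxip A A) = (A != 0).
Proof. by rewrite lt0r mxip_ge0 andbT mxip_eq0. Qed.

(** The pairs [(c, -b)] and [(b, -a)] turn the form into [c * (a * c - b ^+ 2)] and
    [a * (a * c - b ^+ 2)]. If [a = c = 0], the pair [(1, -b)] forces [b = 0]. *)
Lemma discr_le (a b c : R) :
  (forall s t, 0 <= s ^+ 2 * a + 2 * (s * t) * b + t ^+ 2 * c) ->
  b ^+ 2 <= a * c.
Proof.
move=> pos.
have a0 : 0 <= a by have := pos 1 0; lra.
have c0 : 0 <= c by have := pos 0 1; lra.
have := pos c (- b); have := pos b (- a) => h1 h2.
case: (ltP 0 c) => [cp|c_le0].
  have : 0 <= c * (a * c - b ^+ 2) by lra.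
  by rewrite pmulr_rge0// subr_ge0.
have {c_le0} c_eq0 : c = 0 by lra.
case: (ltP 0 a) => [ap|a_le0].
  have : 0 <= a * (a * c - b ^+ 2) by lra.
  by rewrite pmulr_rge0// subr_ge0.
have := pos 1 (- b); nra.
Qed.

Lemma CauchySchwarz_psd (m : nat) (P : 'M[R]_m) (x y : 'cV[R]_m) :
  P^T = P -> (forall z : 'cV[R]_m, 0 <= mxip z (P *m z)) ->
  mxip x (P *m y) ^+ 2 <= mxip x (P *m x) * mxip y (P *m y).
Proof.
move=> Psym Ppsd; apply: discr_le => s t.
have := Ppsd (s *: x + t *: y).
rewrite mulmxDr -!scalemxAr !(mxipDl, mxipDr, mxipZl, mxipZr).
have -> : mxip y (P *m x) = mxip x (P *m y) by rewrite mxipC mxip_mull Psym.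
lra.
Qed.

Lemma CauchySchwarz_mx (m n : nat) (A B : 'M[R]_(m, n)) :
  mxip A B ^+ 2 <= mxip A A * mxip B B.
Proof.
apply: discr_le => s t; have := mxip_ge0 (s *: A + t *: B).
rewrite !(mxipDl, mxipDr, mxipZl, mxipZr) (mxipC B A).
lra.
Qed.

Lemma mxip_outer (m n : nat) (u1 u2 : 'cV[R]_m) (v1 v2 : 'cV[R]_n) :
  mxip (u1 *m v1^T) (u2 *m v2^T) = mxip u1 u2 * mxip v1 v2.
Proof.
rewrite mxip_mulr trmxK -mulmxA.
have -> : v2^T *m v1 = (mxip v1 v2)%:M.
  by rewrite mxipC /mxip trace_mx11 -mx11_scalar.
by rewrite mul_mx_scalar mxipZr mulrC.
Qed.

(** Pairing [A] with the rank-one matrix [A x x^T] gives |Ax|^2, so Cauchy-Schwarz reads |Ax|^4 <=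
    |A|^2 |Ax|^2 |x|^2. *)
Lemma mxip_mulmx_le (m n : nat) (A : 'M[R]_(m, n)) (x : 'cV[R]_n) :
  mxip (A *m x) (A *m x) <= mxip A A * mxip x x.
Proof.
have [->|Ax0] := eqVneq (A *m x) 0; first by rewrite mxip0l mulr_ge0 ?mxip_ge0.
have /(_ (A *m x *m x^T)) := CauchySchwarz_mx A.
rewrite mxip_outer -mxip_mulr mulrCA expr2.
by rewrite ler_pM2l ?mxip_gt0.
Qed.

Lemma mxip_dot (m : nat) (u v : 'cV[R]_m) : mxip u v = dot u v.
Proof. by rewrite mxipE; apply: eq_bigr => i _; rewrite big_ord1. Qed.

Lemma norm2E (m : nat) (u : 'cV[R]_m) : norm2 u = Num.sqrt (mxip u u).
Proof. by congr Num.sqrt; rewrite mxip_dot; apply: eq_bigr => i _; rewrite expr2. Qed.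

Lemma norm2_ge0 (m : nat) (u : 'cV[R]_m) : 0 <= norm2 u.
Proof. exact: sqrtr_ge0. Qed.

Lemma sqr_norm2 (m : nat) (u : 'cV[R]_m) : norm2 u ^+ 2 = mxip u u.
Proof. by rewrite norm2E sqr_sqrtr ?mxip_ge0. Qed.

Lemma norm2_eq0 (m : nat) (u : 'cV[R]_m) : (norm2 u == 0) = (u == 0).
Proof. by rewrite -sqrf_eq0 sqr_norm2 mxip_eq0. Qed.

Lemma frobenius_normE (m n : nat) (A : 'M[R]_(m, n)) :
  frobenius_norm A = Num.sqrt (mxip A A).
Proof.
congr Num.sqrt; rewrite mxipE.
by apply: eq_bigr => i _; apply: eq_bigr => j _; rewrite expr2.
Qed.

End InnerProduct.

(** * The spectral norm as an operator norm *)

Section SpectralNorm.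
Context {R : realType}.
Implicit Types m n : nat.

Lemma singular_value_le m n (A : 'M[R]_(m, n)) c s : 0 <= c ->
  (forall x : 'cV[R]_n, mxip (A *m x) (A *m x) <= c ^+ 2 * mxip x x) ->
  singular_values A s -> s <= c.
Proof.
move=> c0 Ac [s0 /eigenvalueP[v vA v0]].
(* [eigenvalueP] yields a row eigenvector; since [A^T *m A] is symmetric, its transpose is a column
   eigenvector. *)
have := Ac v^T.
have -> : mxip (A *m v^T) (A *m v^T) = s ^+ 2 * mxip v^T v^T.
  rewrite mxip_mull mulmxA -mxipZr -linearZ -vA /=.
  by rewrite trmx_mul trmx_mul trmxK.
rewrite ler_pM2r; last by rewrite mxip_gt0 trmx_eq0.
by rewrite ler_sqr.
Qed.

Lemma spectral_norm_le m n (A : 'M[R]_(m, n)) c : 0 <= c ->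
  (forall x : 'cV[R]_n, mxip (A *m x) (A *m x) <= c ^+ 2 * mxip x x) ->
  spectral_norm A <= c.
Proof.
move=> c0 Ac; rewrite /spectral_norm.
have [->|ne] := eqVneq (singular_values A) set0; first by rewrite sup0.
apply: ge_sup; first exact/set0P.
by move=> s; apply: singular_value_le.
Qed.

Lemma spectral_norm_ge0 m n (A : 'M[R]_(m, n)) : 0 <= spectral_norm A.
Proof.
rewrite /spectral_norm.
have [[[s sA] ub]|/sup_out -> //] := pselect (has_sup (singular_values A)).
by apply: le_trans (ub_le_sup ub sA); case: sA.
Qed.

(** Take for [mu] the supremum of |Ax|^2 over the unit sphere. That it is an eigenvalue is shown by
    contradiction, without compactness of the sphere; the dimension [n.+1] keeps the sphere
    nonempty. *)
Lemma max_eigenvalue m n (A : 'M[R]_(m, n.+1)) : exists mu : R,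
  [/\ 0 <= mu, eigenvalue (A^T *m A) mu &
      forall x : 'cV[R]_n.+1, mxip (A *m x) (A *m x) <= mu * mxip x x].
Proof.
pose S : set R :=
  [set mxip (A *m x) (A *m x) | x in [set x : 'cV[R]_n.+1 | mxip x x = 1]]%classic.
have Sub : ubound S (mxip A A).
  by move=> _ [x x1 <-]; rewrite -[leRHS]mulr1 -x1 mxip_mulmx_le.
have e1 : mxip (delta_mx 0 0 : 'cV[R]_n.+1) (delta_mx 0 0) = 1.
  rewrite mxipE (bigD1 0)//= big_ord1 !mxE !eqxx mulr1 big1 ?addr0// => i i0.
  by rewrite big_ord1 !mxE (negbTE i0) mul0r.
have S0 : (S !=set0)%classic by eexists; exists (delta_mx 0 0).
have Ssup : has_sup S by split => //; exists (mxip A A).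
set mu := sup S.
have Amu (x : 'cV[R]_n.+1) : mxip (A *m x) (A *m x) <= mu * mxip x x.
  have [->|x0] := eqVneq x 0; first by rewrite mulmx0 !mxip0l mulr0.
  have xp : 0 < mxip x x by rewrite mxip_gt0.
  rewrite -ler_pdivrMr//.
  apply: ub_le_sup; first by exists (mxip A A).
  exists ((norm2 x)^-1 *: x) => /=.
    by rewrite mxipZl mxipZr mulrA -expr2 exprVn sqr_norm2 mulVf ?gt_eqF.
  rewrite -scalemxAr mxipZl mxipZr mulrA -expr2 exprVn sqr_norm2 mulrC//.
have mu0 : 0 <= mu.
  by have := Amu (delta_mx 0 0); rewrite e1 mulr1; apply: le_trans; exact: mxip_ge0.
exists mu; split => //; apply: contraT => neig.
(* If [mu] is not an eigenvalue then [P] is invertible, so that [P], being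
   positive semidefinite, is bounded below; this contradicts [mu = sup S]. *)
pose P := mu%:M - A^T *m A.
have Psym : P^T = P by rewrite /P linearB /= tr_scalar_mx trmx_mul trmxK.
have PE (x : 'cV[R]_n.+1) : mxip x (P *m x) = mu * mxip x x - mxip (A *m x) (A *m x).
  rewrite mulmxBl mul_scalar_mx mxipDr mxipZr -scaleN1r mxipZr mulN1r.
  by rewrite mxip_mull mulmxA.
have Ppsd (x : 'cV[R]_n.+1) : 0 <= mxip x (P *m x) by rewrite PE subr_ge0.
have Punit : P \in unitmx.
  rewrite -row_free_unit; apply: inj_row_free => v.
  rewrite mulmxBr mul_mx_scalar => /eqP; rewrite subr_eq0 => /eqP vmu.
  have [//|v0] := eqVneq v 0.
  by case/negP: neig; apply/eigenvalueP; exists v.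
pose J := mxip (invmx P) (invmx P).
(* A lower bound for [mu] - |Ax|^2, uniform on the sphere: |x|^2 <= J |Px|^2 by invertibility, and
   |Px|^2 <= mu <x, Px> because 0 <= P <= mu I. *)
have gap (x : 'cV[R]_n.+1) : mxip x x = 1 ->
    1 <= J * mu * (mu - mxip (A *m x) (A *m x)).
  move=> x1; set q := mu - _.
  have Pq : mxip x (P *m x) = q by rewrite PE x1 mulr1.
  set z := mxip (P *m x) (P *m x).
  have xz : 1 <= J * z.
    by rewrite -x1 -{1 2}[x](mulKmx Punit) mxip_mulmx_le.
  have zp : 0 < z.
    rewrite lt0r mxip_ge0 andbT; apply: contraTneq xz => ->.
    by rewrite mulr0 ler10.
  (* Cauchy-Schwarz for the form of [P] at [x] and [P *m x] gives z^2 <= q <Px, P(Px)> <= q mu z. *)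
  have zq : z <= mu * q.
    have := CauchySchwarz_psd x (P *m x) Psym Ppsd.
    rewrite -{1}Psym -mxip_mull -/z Pq (PE (P *m x)) -/z => zz.
    have q0 : 0 <= q by rewrite -Pq.
    have : z * z <= mu * q * z.
      rewrite -expr2; apply: (le_trans zz).
      rewrite mulrAC mulrC; apply: ler_wpM2r => //.
      by rewrite gerBl mxip_ge0.
    by rewrite ler_pM2r.
  rewrite -mulrA; apply: (le_trans xz); apply: ler_wpM2l => //.
  exact: mxip_ge0.
have Jmu : 0 < J * mu.
  rewrite lt0r mulr_ge0 ?mxip_ge0// andbT.
  by apply: contraTneq (gap _ e1) => ->; rewrite mul0r ler10.
suff : mu <= mu - (J * mu)^-1 by rewrite lerBrDr gerDl invr_le0 leNgt Jmu.
apply: ge_sup => // _ [x x1 <-].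
by rewrite lerBrDr -lerBrDl -div1r ler_pdivrMr// mulrC; apply: gap.
Qed.

(** The square root of the [mu] of [max_eigenvalue] is a singular value and hence below the
    supremum, the set being bounded by that same root. For [n = 0] both sides vanish. *)
Lemma spectral_norm_bound m n (A : 'M[R]_(m, n)) (x : 'cV[R]_n) :
  mxip (A *m x) (A *m x) <= spectral_norm A ^+ 2 * mxip x x.
Proof.
case: n A x => [A x|n A x].
  by rewrite [x]flatmx0 mulmx0 !mxip0l mulr0.
have [mu [mu0 eig Amu]] := max_eigenvalue A.
apply: (le_trans (Amu x)); apply: ler_wpM2r; first exact: mxip_ge0.
rewrite -[leLHS]sqr_sqrtr// ler_sqr ?nnegrE ?sqrtr_ge0 ?spectral_norm_ge0//.
apply: ub_le_sup; last by split; rewrite ?sqrtr_ge0 ?sqr_sqrtr.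
exists (Num.sqrt mu) => s; apply: singular_value_le => [|y]; first exact: sqrtr_ge0.
by rewrite sqr_sqrtr.
Qed.

End SpectralNorm.

(** * Norm axioms and the evaluation of dual norms *)

Lemma spectral_normZ (R : realType) m n (c : R) (A : 'M[R]_(m, n)) :
  spectral_norm (c *: A) = `|c| * spectral_norm A.
Proof.
have le (d : R) (B : 'M[R]_(m, n)) : spectral_norm (d *: B) <= `|d| * spectral_norm B.
  apply: spectral_norm_le => [|x]; first by rewrite mulr_ge0 ?spectral_norm_ge0.
  rewrite -scalemxAl mxipZl mxipZr mulrA -expr2 exprMn real_normK ?num_real//.
  rewrite -[leRHS]mulrA; apply: ler_wpM2l; rewrite ?sqr_ge0 ?spectral_norm_bound//.
have [->|c0] := eqVneq c 0.
  by apply/le_anti; rewrite le /= normr0 mul0r spectral_norm_ge0.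
apply/le_anti; rewrite le /= -ler_pdivlMl ?normr_gt0//.
by have := le c^-1 (c *: A); rewrite scalerA mulVf// scale1r normfV.
Qed.

Lemma spectral_norm0_eq0 (R : realType) m n (A : 'M[R]_(m, n)) :
  spectral_norm A = 0 -> A = 0.
Proof.
move=> A0; apply/matrixP => i j.
have := spectral_norm_bound A (delta_mx j 0).
rewrite A0 expr0n mul0r => le0.
have : mxip (A *m delta_mx j 0) (A *m delta_mx j (0 : 'I_1)) == 0.
  by rewrite eq_le le0 mxip_ge0.
by rewrite mxip_eq0 -colE => /eqP/matrixP/(_ i 0); rewrite !mxE.
Qed.

Lemma frobenius_normZ (R : realType) m n (c : R) (A : 'M[R]_(m, n)) :
  frobenius_norm (c *: A) = `|c| * frobenius_norm A.
Proof.
by rewrite !frobenius_normE mxipZl mxipZr mulrA -expr2 sqrtrM ?sqr_ge0// sqrtr_sqr.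
Qed.

Lemma frobenius_norm0_eq0 (R : realType) m n (A : 'M[R]_(m, n)) :
  frobenius_norm A = 0 -> A = 0.
Proof.
move=> /eqP; rewrite frobenius_normE sqrtr_eq0 => le0.
by apply/eqP; rewrite -mxip_eq0 eq_le le0 mxip_ge0.
Qed.

(* The supremum is taken over the unit sphere, which is empty when there is no
   nonzero matrix; the junk value [sup set0 = 0] is then the right one. *)
Lemma dual_norm_eq (R : realType) m n (N : 'M[R]_(m, n) -> R) G t :
  (forall B, 0 <= N B) -> (forall B, N B = 0 -> B = 0) ->
  (forall c B, N (c *: B) = `|c| * N B) ->
  (forall B, N B <= 1 -> mxip G B <= t) ->
  (exists2 B, N B <= 1 & mxip G B = t) ->
  dual_norm N G = t.
Proof.
move=> N0 N_eq0 NZ Gle [B NB GB]; rewrite /dual_norm.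
set S := [set _ | _ in _]%classic.
have t0 : 0 <= t.
  have /Gle : N 0 <= 1 by rewrite -(scale0r B) NZ normr0 mul0r.
  by rewrite mxip0r.
have St : ubound S t by move=> _ [C /= NC <-]; apply: Gle; rewrite NC.
have scaled C : C != 0 -> S (mxip G C / N C).
  move=> C0; have NC : N C != 0 by apply: contra_neq C0 => /N_eq0.
  exists ((N C)^-1 *: C) => /=; first by rewrite NZ ger0_norm ?invr_ge0// mulVf.
  by rewrite -/(mxip _ _) mxipZr mulrC.
have [SS|/set0P/negP/negPn/eqP S0] := pselect (S !=set0)%classic; last first.
  rewrite S0 sup0; have [B0|/scaled] := eqVneq B 0; last by rewrite S0.
  by rewrite -GB B0 mxip0r.
apply/le_anti/andP; split; first exact: ge_sup.
have hS : has_sup S by split => //; exists t.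
(* For [t = 0] the witness [B] may be zero and cannot be normalised. Any [C] on the unit sphere
   serves instead: the values at [C] and [-C] are opposite, so the supremum is at least 0. *)
have [t_eq0|tn0] := eqVneq t 0.
  have [_ [C /= NC _]] := SS.
  have C0 : C != 0.
    apply/eqP => C0; move: NC; rewrite C0 -(scale0r B) NZ normr0 mul0r => /eqP.
    by rewrite eq_sym oner_eq0.
  have le1 := ub_le_sup hS.2 (scaled _ C0).
  have C0' : (- 1 : R) *: C != 0 by rewrite scaler_eq0 oppr_eq0 oner_eq0.
  have := ub_le_sup hS.2 (scaled _ C0').
  rewrite NZ normrN1 mul1r mxipZr mulN1r mulNr t_eq0; lra.
have B0 : B != 0 by apply: contra_neq tn0 => B0; rewrite -GB B0 mxip0r.
apply: le_trans (ub_le_sup hS.2 (scaled _ B0)).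
have NBp : 0 < N B by rewrite lt0r N0 andbT; apply: contra_neq B0 => /N_eq0.
by rewrite GB ler_pdivlMr// ler_piMr.
Qed.

Lemma dual_frobenius_norm (R : realType) m n (G : 'M[R]_(m, n)) :
  dual_norm (@frobenius_norm R m n) G = frobenius_norm G.
Proof.
have sqrF (B : 'M[R]_(m, n)) : frobenius_norm B ^+ 2 = mxip B B.
  by rewrite frobenius_normE sqr_sqrtr ?mxip_ge0.
have F0 (B : 'M[R]_(m, n)) : 0 <= frobenius_norm B by rewrite frobenius_normE sqrtr_ge0.
apply: dual_norm_eq => //.
- exact: frobenius_norm0_eq0.
- by move=> c B; rewrite frobenius_normZ.
- move=> B NB; apply: le_trans (ler_norm _) _.
  rewrite -ler_sqr ?nnegrE// real_normK ?num_real//.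
  apply: le_trans (CauchySchwarz_mx _ _) _; rewrite sqrF ler_piMr ?mxip_ge0//.
  by rewrite -sqrF expr_le1.
- have [->|G0] := eqVneq G 0.
    exists 0; rewrite ?mxip0l frobenius_normE mxip0l sqrtr0//.
  have FG : frobenius_norm G != 0 by apply: contra_neq G0 => /frobenius_norm0_eq0.
  exists ((frobenius_norm G)^-1 *: G).
    by rewrite frobenius_normZ ger0_norm ?invr_ge0// mulVf.
  by rewrite mxipZr -sqrF expr2 mulKf.
Qed.

(** * Contractions, the unit ball of the spectral norm *)

Section Contraction.
Context {R : realType}.
Implicit Types m n p : nat.

Definition l2contraction m n (A : 'M[R]_(m, n)) :=
  forall x : 'cV[R]_n, mxip (A *m x) (A *m x) <= mxip x x.

Lemma l2contractionP m n (A : 'M[R]_(m, n)) :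
  l2contraction A <-> spectral_norm A <= 1.
Proof.
split=> [cA|A1 x].
  by apply: spectral_norm_le => // x; rewrite expr1n mul1r.
apply: le_trans (spectral_norm_bound A x) _.
by rewrite ler_piMl ?mxip_ge0// expr_le1 ?spectral_norm_ge0.
Qed.

Lemma l2contraction_mul m n p (A : 'M[R]_(m, n)) (B : 'M[R]_(n, p)) :
  l2contraction A -> l2contraction B -> l2contraction (A *m B).
Proof.
by move=> cA cB x; rewrite -mulmxA; apply: le_trans (cA _) (cB x).
Qed.

(** By Cauchy-Schwarz, |A^T y|^4 = <y, A A^T y>^2 <= |y|^2 |A A^T y|^2 <= |y|^2 |A^T y|^2. *)
Lemma l2contraction_tr m n (A : 'M[R]_(m, n)) : l2contraction A -> l2contraction A^T.
Proof.
move=> cA y; set z := mxip _ _.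
have [->|z0] := eqVneq z 0; first exact: mxip_ge0.
have zp : 0 < z by rewrite lt0r z0 mxip_ge0.
rewrite -(ler_pM2r zp) -expr2.
have zE : z = mxip y (A *m (A^T *m y)) by rewrite mxipC mxip_mull.
rewrite [in leLHS]zE; apply: le_trans (CauchySchwarz_mx _ _) _.
by apply: ler_wpM2l; [exact: mxip_ge0|exact: cA].
Qed.

Lemma l2contraction_unit n (x : 'cV[R]_n) : mxip x x <= 1 -> l2contraction x.
Proof.
by move=> x1 s; apply: le_trans (mxip_mulmx_le _ _) _; rewrite ler_piMl ?mxip_ge0.
Qed.

Lemma l2contraction_mx m n p (A : 'M[R]_(m, n)) (X : 'M[R]_(n, p)) :
  l2contraction A -> mxip (A *m X) (A *m X) <= mxip X X.
Proof.
have col_sum q (Y : 'M[R]_(q, p)) : mxip Y Y = \sum_j mxip (col j Y) (col j Y).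
  rewrite mxipE exchange_big; apply: eq_bigr => j _.
  by rewrite mxipE; apply: eq_bigr => i _; rewrite big_ord1 !mxE.
move=> cA; rewrite !col_sum; apply: ler_sum => j _.
by rewrite colE -mulmxA -colE; apply: cA.
Qed.

(** Since [A^T] is also a contraction, |A^T A x - x|^2 = |A^T A x|^2 - 2 |Ax|^2 + |x|^2 <= |Ax|^2 -
    |x|^2 = 0. *)
Lemma l2contraction_isometric m n (A : 'M[R]_(m, n)) (x : 'cV[R]_n) :
  l2contraction A -> mxip (A *m x) (A *m x) = mxip x x -> A^T *m (A *m x) = x.
Proof.
move=> cA Ax; apply/eqP; rewrite -subr_eq0 -mxip_eq0 eq_le mxip_ge0 andbT.
have := l2contraction_tr cA (A *m x); rewrite Ax.
have e : mxip (A^T *m (A *m x)) x = mxip x x by rewrite mxip_mull trmxK.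
rewrite -scaleN1r !(mxipDl, mxipDr, mxipZl, mxipZr) (mxipC x) e; lra.
Qed.

End Contraction.

(** * The nuclear norm of a 2x2 matrix, and plane models of vector pairs *)

Section Planar.
Context {R : realType}.
Implicit Types M K : 'M[R]_2.

(* [M] plus its cofactor matrix; for [det M >= 0] this is the nuclear norm of
   [M] times the rotation in its polar decomposition. *)
Definition polar_rot M : 'M[R]_2 := \matrix_(i, j)
  (if i == j then M 0 0 + M 1 1
   else if i == 0 then M 0 1 - M 1 0 else M 1 0 - M 0 1).

(* The nuclear norm of [M] only when [det M >= 0]. *)
Definition planar_nuclear M : R :=
  Num.sqrt ((M 0 0 + M 1 1) ^+ 2 + (M 0 1 - M 1 0) ^+ 2).

Definition planar_det M : R := M 0 0 * M 1 1 - M 0 1 * M 1 0.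

Lemma ord2P (P : 'I_2 -> Prop) : P 0 -> P 1 -> forall i, P i.
Proof.
move=> P0 P1 [[|[|//]] i2].
  by have -> : Ordinal i2 = 0 by exact/val_inj.
by have -> : Ordinal i2 = 1 by exact/val_inj.
Qed.

Lemma big_ord2 (F : 'I_2 -> R) : \sum_i F i = F 0 + F 1.
Proof.
by rewrite !big_ord_recl big_ord0 addr0; congr (_ + F _); exact/val_inj.
Qed.

Lemma sqr_planar_nuclear M :
  planar_nuclear M ^+ 2 = (M 0 0 + M 1 1) ^+ 2 + (M 0 1 - M 1 0) ^+ 2.
Proof. by rewrite sqr_sqrtr// addr_ge0 ?sqr_ge0. Qed.

Lemma planar_nuclear_ge0 M : 0 <= planar_nuclear M.
Proof. exact: sqrtr_ge0. Qed.

Lemma polar_rot_conformal M :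
  (polar_rot M)^T *m polar_rot M = (planar_nuclear M ^+ 2)%:M.
Proof.
rewrite sqr_planar_nuclear.
by apply/matrixP; elim/ord2P; elim/ord2P; rewrite !mxE big_ord2 !mxE /=; ring.
Qed.

Lemma polar_rot_ip p M (X : 'M[R]_(2, p)) :
  mxip (polar_rot M *m X) (polar_rot M *m X) = planar_nuclear M ^+ 2 * mxip X X.
Proof.
by rewrite mxip_mull mulmxA polar_rot_conformal mul_scalar_mx mxipZr.
Qed.

(** With Q = M + cof M and (cof M)^T M = (det M) I, one has Q^T M = M^T M + (det M) I; multiply on
    the left by Q and use Q Q^T = t^2 I. *)
Lemma polar_rotE M : planar_nuclear M ^+ 2 *: M =
  polar_rot M *m M^T *m M + planar_det M *: polar_rot M.
Proof.
rewrite sqr_planar_nuclear /planar_det.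
by apply/matrixP; elim/ord2P; elim/ord2P;
  rewrite !mxE !big_ord2 !mxE !big_ord2 !mxE /=; ring.
Qed.

Lemma planar_nuclear_ip M :
  planar_nuclear M ^+ 2 = mxip M M + 2 * planar_det M.
Proof. by rewrite sqr_planar_nuclear mxipE !big_ord2 /planar_det; ring. Qed.

Lemma mxip_polar_rot M : mxip M (polar_rot M) = planar_nuclear M ^+ 2.
Proof. by rewrite sqr_planar_nuclear mxipE !big_ord2 !mxE /=; ring. Qed.

(** Pair [polar_rotE] with [K]: the first term is <Q M^T, K M^T> <= t |M|^2 and, as det M >= 0, the
    second is at most 2 t det M. Their sum is t^3 by [planar_nuclear_ip]. *)
Lemma planar_nuclear_le M K : 0 <= planar_det M -> l2contraction K ->
  mxip M K <= planar_nuclear M.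
Proof.
move=> D0 cK; set t := planar_nuclear M.
(* As det M >= 0, [t = 0] forces [M = 0]. *)
have [t0|tn0] := eqVneq t 0.
  have := planar_nuclear_ip M; rewrite -/t t0 expr0n /= => e.
  have /eqP : mxip M M = 0 by have := mxip_ge0 M; lra.
  by rewrite mxip_eq0 => /eqP ->; rewrite mxip0l.
have tp : 0 < t by rewrite lt0r tn0 planar_nuclear_ge0.
have rotK p (X : 'M[R]_(2, p)) :
    mxip (polar_rot M *m X) (K *m X) <= t * mxip X X.
  rewrite -(ler_pM2l tp).
  (* Expand |QX - t KX|^2 >= 0, where |QX| = t |X| and |KX| <= |X|. *)
  have := mxip_ge0 (polar_rot M *m X + (- t) *: (K *m X)).
  rewrite !(mxipDl, mxipDr, mxipZl, mxipZr) polar_rot_ip -/t.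
  rewrite (mxipC (K *m X)).
  have := l2contraction_mx X cK; set a := mxip (K *m X) _; set b := mxip X X.
  have := sqr_ge0 t; nra.
have t2 : 0 < t ^+ 2 by rewrite exprn_gt0.
rewrite -(ler_pM2l t2) -mxipZl polar_rotE mxipDl mxipZl mxip_mulr.
have := rotK _ M^T; rewrite {2}/mxip mxtrace_mulC -/(mxip _ _) trmxK => h1.
have := rotK _ 1%:M; rewrite !mulmx1 => h2.
have h3 : mxip (1%:M : 'M[R]_2) 1%:M = 2.
  by rewrite /mxip trmx1 mulmx1 mxtrace1.
rewrite h3 in h2.
have h4 : planar_det M * mxip (polar_rot M) K <= planar_det M * (t * 2).
  exact: ler_wpM2l.
have e := planar_nuclear_ip M; rewrite -/t in e.
rewrite e; lra.
Qed.

Definition polar_vec (r th : R) : 'cV[R]_2 :=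
  \col_i (if i == 0 then r * cos th else r * sin th).

Lemma mxip_polar_vec r th : mxip (polar_vec r th) (polar_vec r th) = r ^+ 2.
Proof.
rewrite mxipE !big_ord2 !big_ord1 !mxE /=.
by have := cos2Dsin2 th; nra.
Qed.

(** The columns of [E] come from Gram-Schmidt on [u1], [u2]. For parallel vectors the second column
    is 0, so [E] is only a contraction; this also covers [m = 1], where no orthonormal pair
    exists. *)
Lemma planar_frame m (u1 u2 : 'cV[R]_m) th : is_angle th u1 u2 ->
  exists E : 'M[R]_(m, 2), [/\ l2contraction E,
    E *m polar_vec (norm2 u1) 0 = u1 & E *m polar_vec (norm2 u2) th = u2].
Proof.
move=> [/andP[th0 thpi] angle].
have sin_th0 : 0 <= sin th by apply: sin_ge0_pi; rewrite th0.
(* Here [th] is arbitrary, so a rank-one [E] sends the unit vector at angle [th] to the normalised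
   [u2]; if [u2 = 0] too, then [E = 0]. *)
have [u1_0|u10] := eqVneq u1 0.
  exists (((norm2 u2)^-1 *: u2) *m (polar_vec 1 th)^T); split.
  - apply: l2contraction_mul; last first.
      by apply/l2contraction_tr/l2contraction_unit; rewrite mxip_polar_vec expr1n.
    apply: l2contraction_unit; rewrite mxipZl mxipZr -sqr_norm2 mulrA -expr2 exprVn.
    by have [->|n0] := eqVneq (norm2 u2) 0; rewrite ?expr0n ?mulr0 // mulVf ?expf_neq0.
  - have -> : polar_vec (norm2 u1) 0 = 0.
      apply/eqP; rewrite -mxip_eq0 mxip_polar_vec u1_0 sqr_norm2 mxip0l //.
    by rewrite mulmx0 u1_0.
  - have -> : polar_vec (norm2 u2) th = norm2 u2 *: polar_vec 1 th.
      by apply/matrixP => i j; rewrite !mxE; case: ifP => _; ring.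
    rewrite -scalemxAr -mulmxA -scalemxAl.
    rewrite [_^T *m _]mx11_scalar -trace_mx11 -/(mxip _ _) mxip_polar_vec expr1n mulmx1.
    rewrite scalerA; have [/eqP|n0] := eqVneq (norm2 u2) 0.
      by rewrite norm2_eq0 => /eqP ->; rewrite scaler0.
    by rewrite mulfV// scale1r.
have n1 : norm2 u1 != 0 by rewrite norm2_eq0.
pose e1 := (norm2 u1)^-1 *: u1.
have e11 : mxip e1 e1 = 1.
  by rewrite mxipZl mxipZr -sqr_norm2 mulrA -expr2 exprVn mulVf ?expf_neq0.
have dot12 : mxip e1 u2 = norm2 u2 * cos th.
  have [->|u20] := eqVneq u2 0.
    by rewrite mxip0r norm2E mxip0l sqrtr0 mul0r.
  have n2 : norm2 u2 != 0 by rewrite norm2_eq0.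
  rewrite angle// mxipZl mxip_dot.
  by field; rewrite n2 n1.
have e1u : norm2 u1 *: e1 = u1 by rewrite scalerA mulfV// scale1r.
clearbody e1; pose r := u2 - (norm2 u2 * cos th) *: e1.
have re : mxip r e1 = 0.
  rewrite /r -scaleN1r !(mxipDl, mxipZl) (mxipC u2) dot12 e11; ring.
(* Pythagoras; no absolute value remains because [sin th] is nonnegative on [0, pi]. *)
have rr : norm2 r = norm2 u2 * sin th.
  rewrite norm2E.
  have -> : mxip r r = (norm2 u2 * sin th) ^+ 2.
    rewrite {2}/r -scaleN1r !(mxipDr, mxipZr) re /r -scaleN1r !(mxipDl, mxipZl).
    rewrite dot12 -sqr_norm2 exprMn sin2cos2; ring.
  by rewrite sqrtr_sqr ger0_norm// mulr_ge0 ?norm2_ge0.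
pose e2 := (norm2 r)^-1 *: r.
have e2r : (norm2 u2 * sin th) *: e2 = r.
  rewrite -rr scalerA; have [/eqP|n0] := eqVneq (norm2 r) 0.
    by rewrite norm2_eq0 => /eqP ->; rewrite scaler0.
  by rewrite mulfV// scale1r.
have e22 : mxip e2 e2 <= 1.
  rewrite mxipZl mxipZr -sqr_norm2 mulrA -expr2 exprVn.
  by have [->|n0] := eqVneq (norm2 r) 0; rewrite ?expr0n ?mulr0 // mulVf ?expf_neq0.
have e12 : mxip e1 e2 = 0 by rewrite mxipZr (mxipC e1) re mulr0.
clearbody e2; pose E : 'M[R]_(m, 2) := \matrix_(i, j) (if j == 0 then e1 i 0 else e2 i 0).
have Emul (x : 'cV[R]_2) : E *m x = x 0 0 *: e1 + x 1 0 *: e2.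
  by apply/matrixP => i j; rewrite [j]ord1 !mxE big_ord2 !mxE /=; ring.
exists E; split => [x||].
- rewrite Emul !(mxipDl, mxipDr, mxipZl, mxipZr) (mxipC e2 e1) e12 e11.
  rewrite [leRHS]mxipE big_ord2 !big_ord1.
  have := sqr_ge0 (x 1 0); nra.
- by rewrite Emul !mxE /= cos0 sin0 !mulr0 mulr1 scale0r addr0.
- by rewrite Emul !mxE /= e2r /r addrC subrK.
Qed.

End Planar.

(** * Transfer to the plane and the two formulas *)

Lemma dual_spectral_norm_eq (R : realType) m n (G : 'M[R]_(m, n)) t :
  (forall B, l2contraction B -> mxip G B <= t) ->
  (exists2 B, l2contraction B & mxip G B = t) ->
  dual_norm (@spectral_norm R m n) G = t.
Proof.
move=> Gle [B cB GB]; apply: dual_norm_eq.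
- by move=> C; apply: spectral_norm_ge0.
- by move=> C; apply: spectral_norm0_eq0.
- by move=> c C; apply: spectral_normZ.
- by move=> C /l2contractionP; apply: Gle.
- by exists B => //; apply/l2contractionP.
Qed.

(** Upper bound: <E M F^T, B> = <M, E^T B F>, and E^T B F is again a contraction. Attainment: E
    (Q/t) F^T is a contraction, and its pairing with G is that of Q/t with E^T G F = M. *)
Lemma dual_spectral_norm_frame (R : realType) m n (E : 'M[R]_(m, 2))
    (F : 'M[R]_(n, 2)) (x1 x2 y1 y2 : 'cV[R]_2) :
  l2contraction E -> l2contraction F ->
  mxip (E *m x1) (E *m x1) = mxip x1 x1 ->
  mxip (E *m x2) (E *m x2) = mxip x2 x2 ->
  mxip (F *m y1) (F *m y1) = mxip y1 y1 ->
  mxip (F *m y2) (F *m y2) = mxip y2 y2 ->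
  0 <= planar_det (x1 *m y1^T + x2 *m y2^T) ->
  dual_norm (@spectral_norm R m n)
    (E *m x1 *m (F *m y1)^T + E *m x2 *m (F *m y2)^T) =
  planar_nuclear (x1 *m y1^T + x2 *m y2^T).
Proof.
move=> cE cF Ex1 Ex2 Fy1 Fy2; set M := x1 *m _ + _ => D0; set G := _ + _.
have GE : G = E *m M *m F^T.
  by rewrite /G /M mulmxDr mulmxDl !trmx_mul !mulmxA.
have EMF : E^T *m G *m F = M.
  rewrite /G mulmxDr mulmxDl; congr (_ + _).
    rewrite !mulmxA -(mulmxA E^T) l2contraction_isometric// -mulmxA.
    by rewrite -[(F *m y1)^T *m F]trmxK trmx_mul trmxK l2contraction_isometric.
  rewrite !mulmxA -(mulmxA E^T) l2contraction_isometric// -mulmxA.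
  by rewrite -[(F *m y2)^T *m F]trmxK trmx_mul trmxK l2contraction_isometric.
set t := planar_nuclear M; apply: dual_spectral_norm_eq => [B cB|].
  rewrite GE mxip_mulr trmxK mxip_mull mulmxA; apply: planar_nuclear_le => //.
  by apply: l2contraction_mul => //; apply: l2contraction_mul => //; apply: l2contraction_tr.
(* for [t = 0] the witness is [0], as [0^-1 = 0] *)
exists (E *m (t^-1 *: polar_rot M) *m F^T).
  apply: l2contraction_mul; last exact: l2contraction_tr.
  apply: l2contraction_mul => // x.
  rewrite -scalemxAl mxipZl mxipZr polar_rot_ip -/t mulrA mulrA -expr2 -exprMn.
  have [->|t0] := eqVneq t 0; first by rewrite mulr0 expr0n mul0r mxip_ge0.
  by rewrite mulVf// expr1n mul1r.
rewrite mxipC mxip_mulr trmxK mxip_mull mulmxA EMF mxipZl mxipC mxip_polar_rot.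
rewrite -/t expr2; have [->|t0] := eqVneq t 0; first by rewrite !mulr0.
by rewrite mulKf.
Qed.

Lemma angle_mxip (R : realType) m (u1 u2 : 'cV[R]_m) th :
  is_angle th u1 u2 -> mxip u1 u2 = norm2 u1 * norm2 u2 * cos th.
Proof.
move=> [_ angle].
have [->|u10] := eqVneq u1 0; first by rewrite mxip0l norm2E mxip0l sqrtr0 !mul0r.
have [->|u20] := eqVneq u2 0.
  by rewrite mxip0r [norm2 0]norm2E mxip0l sqrtr0 mulr0 mul0r.
by rewrite angle// mxip_dot mulrC divfK// mulf_neq0 ?norm2_eq0.
Qed.

Unset Implicit Arguments.

Theorem lemma6p3 (R : realType) (m n : nat)
    (u1 u2 : 'cV[R]_m) (v1 v2 : 'cV[R]_n) (theta_u theta_v : R)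
    (hu : is_angle theta_u u1 u2) (hv : is_angle theta_v v1 v2) :
  (dual_norm (@frobenius_norm R m n) (u1 *m v1^T + u2 *m v2^T) =
     frobenius_norm (u1 *m v1^T + u2 *m v2^T) /\
   frobenius_norm (u1 *m v1^T + u2 *m v2^T) =
     Num.sqrt (norm2 u1 ^+ 2 * norm2 v1 ^+ 2 + norm2 u2 ^+ 2 * norm2 v2 ^+ 2
       + 2 * norm2 u1 * norm2 v1 * norm2 u2 * norm2 v2
         * cos theta_u * cos theta_v)) /\
  dual_norm (@spectral_norm R m n) (u1 *m v1^T + u2 *m v2^T) =
    Num.sqrt (norm2 u1 ^+ 2 * norm2 v1 ^+ 2 + norm2 u2 ^+ 2 * norm2 v2 ^+ 2
      + 2 * norm2 u1 * norm2 v1 * norm2 u2 * norm2 v2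
        * cos (theta_u - theta_v)).
Proof.
split; [split; first exact: dual_frobenius_norm|].
  rewrite frobenius_normE; congr Num.sqrt.
  rewrite !(mxipDl, mxipDr) !mxip_outer (mxipC u2 u1) (mxipC v2 v1).
  by rewrite (angle_mxip hu) (angle_mxip hv) -!sqr_norm2; ring.
have [E [cE Eu1 Eu2]] := planar_frame hu.
have [F [cF Fv1 Fv2]] := planar_frame hv.
have [/andP[u_ge0 u_lepi] _] := hu; have [/andP[v_ge0 v_lepi] _] := hv.
have sinu : 0 <= sin theta_u by apply: sin_ge0_pi; rewrite u_ge0.
have sinv : 0 <= sin theta_v by apply: sin_ge0_pi; rewrite v_ge0.
rewrite -[in LHS]Eu1 -[in LHS]Eu2 -[in LHS]Fv1 -[in LHS]Fv2.
rewrite dual_spectral_norm_frame ?(Eu1, Eu2, Fv1, Fv2) ?mxip_polar_vec -?sqr_norm2 //.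
  congr Num.sqrt; rewrite !mxE !big_ord1 !mxE /= cos0 sin0 cosB.
  have := cos2Dsin2 theta_u; have := cos2Dsin2 theta_v.
  set cu := cos theta_u; set su := sin theta_u.
  set cv := cos theta_v; set sv := sin theta_v => ev eu.
  (* With a = |u1||v1| and b = |u2||v2|, the squares expand to a^2 + 2ab cos(theta_u - theta_v) plus
     b^2 times this product of Pythagorean sums. *)
  have -> : norm2 u2 ^+ 2 * norm2 v2 ^+ 2 = norm2 u2 ^+ 2 * norm2 v2 ^+ 2 *
    ((cu ^+ 2 + su ^+ 2) * (cv ^+ 2 + sv ^+ 2)) by rewrite eu ev !mulr1.
  ring.
rewrite /planar_det !mxE !big_ord1 !mxE /= cos0 sin0.
rewrite [leRHS](_ : _ = norm2 u1 * norm2 v1 * (norm2 u2 * norm2 v2) *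
  (sin theta_u * sin theta_v)); last by ring.
by rewrite !mulr_ge0 ?norm2_ge0.
Qed.
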